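(* If $G$ is a co-comparability graph with at least two vertices, then $\mathrm{thin}(G)\leq |V(G)|/2$.
   Context: Graphs are finite, simple, undirected. A graph $H$ is a comparability graph if there is an ordering $v_1,\dots,v_n$ of $V(H)$ such that for each $r<s<t$, if $v_rv_s$ and $v_sv_t$ are edges then $v_rv_t$ is an edge; $G$ is a co-comparability graph if its complement is a comparability graph. For a graph $G=(V,E)$, an ordering $v_1,\dots,v_n$ of $V$ and a partition of $V$ are consistent if for every $r<s<t$, whenever $v_r,v_s$ are in the same class and $v_tv_r\in E$, then $v_tv_s\in E$. $\mathrm{thin}(G)$ is the minimum number of classes of a partition of $V$ consistent with some ordering of $V$. *)

(* Defs.v *)
From mathcomp Require Import all_boot all_order all_algebra.

Set Implicit Arguments.
Unset Strict Implicit.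
Unset Printing Implicit Defensive.

Record sgraph := SGraph {
  vertex :> finType;
  edge : rel vertex;
  edge_sym : symmetric edge;
  edge_irrefl : irreflexive edge
}.

Section Complement.
Variable G : sgraph.

Definition compl_edge : rel G := fun x y => (x != y) && ~~ edge x y.

Lemma compl_edge_sym : symmetric compl_edge.
Proof. by move=> x y; rewrite /compl_edge eq_sym edge_sym. Qed.

Lemma compl_edge_irrefl : irreflexive compl_edge.
Proof. by move=> x; rewrite /compl_edge eqxx. Qed.

Definition compl : sgraph := SGraph compl_edge_sym compl_edge_irrefl.

End Complement.

Section Thinness.
Variable G : sgraph.

(* An ordering v_1, ..., v_n of V(G) is an injective v : 'I_#|G| -> G; it is
   bijective by cardinality.  Indices start at 0. *)
Definition is_ordering (v : {ffun 'I_#|G| -> G}) : bool := injectiveb v.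

Definition comparability : bool :=
  [exists v : {ffun 'I_#|G| -> G}, is_ordering v &&
    [forall r : 'I_#|G|, forall s : 'I_#|G|, forall t : 'I_#|G|,
      [&& r < s, s < t, edge (v r) (v s) & edge (v s) (v t)]
        ==> edge (v r) (v t)]].

Definition same_class (P : {set {set G}}) (x y : G) : bool :=
  [exists C in P, (x \in C) && (y \in C)].

Definition consistent (v : {ffun 'I_#|G| -> G}) (P : {set {set G}}) : bool :=
  [forall r : 'I_#|G|, forall s : 'I_#|G|, forall t : 'I_#|G|,
    [&& r < s, s < t, same_class P (v r) (v s) & edge (v t) (v r)]
      ==> edge (v t) (v s)].

Definition thin_with (k : nat) : bool :=
  [exists v : {ffun 'I_#|G| -> G}, exists P : {set {set G}},
    [&& is_ordering v, partition P [set: G], consistent v P & #|P| == k]].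

Lemma thin_with_ex : exists k, thin_with k.
Proof.
pose P := preim_partition (@id G) [set: G].
have partP : partition P [set: G] by apply: preim_partitionP.
exists #|P|; apply/existsP; exists [ffun i => enum_val i].
apply/existsP; exists P; rewrite partP eqxx andbT /=.
have inj_v : injective [ffun i : 'I_#|G| => enum_val i : G].
  by move=> i j; rewrite !ffunE => /enum_val_inj.
apply/andP; split; first exact/injectiveP.
apply/forallP=> r; apply/forallP=> s; apply/forallP=> t; apply/implyP.
case/and4P=> lt_rs _ /exists_inP[C /imsetP[z _ ->]].
rewrite !inE => /andP[/eqP zr /eqP zs] _; move: lt_rs.
by rewrite (inj_v _ _ (etrans (esym zr) zs)) ltnn.
Qed.

Definition thin : nat := ex_minn thin_with_ex.

End Thinness.

Definition co_comparability (G : sgraph) : bool := comparability (compl G).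

(* Main.v *)
(** Two bounds on the thinness are combined.

    If [K] is a clique missing some vertex [s], order the vertices as
    [V \ (K + s)], then [s], then [K]; the partition into [K + s] and
    singletons is consistent, because the last two vertices of any triple
    starting in [K + s] lie in [K].  Hence [thin G <= n - #|K|].

    If [G] is a co-comparability graph, its non-edges form a strict partial
    order compatible with the given vertex ordering, and any partition into
    chains (independent sets of [G]) is consistent with that ordering.  By
    Dilworth's theorem, some clique [K] of [G] satisfies [thin G <= #|K|].

    One of [n - #|K|] and [#|K|] is at most [n / 2]. *)
Require Import Defs.
From mathcomp Require Import all_boot all_order all_algebra.
From mathcomp Require Import zify.
Local Open Scope ring_scope.

(** * Dilworth's theorem for finite strict partial orders *)

Section Dilworth.
Local Set Implicit Arguments.
Local Unset Strict Implicit.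
Local Open Scope nat_scope.
Variables (T : finType) (lt : rel T).
Hypotheses (lt_irr : irreflexive lt) (lt_trans : transitive lt).

Definition antichain (Q : {set T}) : bool :=
  [forall x in Q, forall y in Q, ~~ lt x y].

Lemma antichainP (Q : {set T}) :
  reflect {in Q &, forall x y, ~~ lt x y} (antichain Q).
Proof.
apply: (iffP forall_inP) => [h x y xQ yQ | h x xQ].
  exact: (forall_inP (h x xQ)).
by apply/forall_inP => y yQ; exact: h.
Qed.

(** A cover of [A] by [k] chains, given by colours; values of [f] off [A] are free. *)
Definition chain_coloring (A : {set T}) (k : nat) (f : T -> nat) : Prop :=
  {in A, forall x, f x < k} /\
  {in A &, forall x y, f x = f y -> [|| x == y, lt x y | lt y x]}.

Lemma exists_maximal (A : {set T}) x : x \in A ->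
  exists2 a, a \in A & {in A, forall y, ~~ lt a y}.
Proof.
(* An element of [A] with the fewest elements above it is maximal. *)
move=> xA; pose d z := #|[set y in A | lt z y]|.
case: (arg_minnP d xA) => a aA mina; exists a => // y yA.
apply/negP => lay; have := mina y yA; rewrite leqNgt => /negP; apply.
apply: proper_card; apply/properP; split.
  by apply/subsetP => z; rewrite !inE => /andP[-> /(lt_trans lay)].
by exists y; rewrite !inE yA ?lay // lt_irr.
Qed.

(** Elements of one colour are comparable, so [f] is injective on [Q]; with [k] elements and [k]
    colours it is also onto. *)
Lemma antichain_meets_color (A Q : {set T}) k f :
  chain_coloring A k f -> antichain Q -> Q \subset A -> #|Q| = k ->
  forall c, c < k -> exists2 x, x \in Q & f x = c.
Proof.
move=> [fk fch] /antichainP aQ /subsetP sQA cQ c ck.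
pose g x : option 'I_k := insub (f x).
have gE x : x \in Q -> omap val (g x) = Some (f x).
  by move=> xQ; rewrite /g insubT ?fk ?sQA.
have g_inj : {in Q &, injective g}.
  move=> x y xQ yQ /(congr1 (omap val)); rewrite !gE // => -[fxy].
  have := fch x y (sQA _ xQ) (sQA _ yQ) fxy.
  by rewrite (negPf (aQ x y xQ yQ)) (negPf (aQ y x yQ xQ)) !orbF => /eqP.
have sub : g @: Q \subset Some @: [set: 'I_k].
  apply/subsetP => _ /imsetP[x xQ ->]; rewrite /g insubT ?fk ?sQA // => lx.
  exact: imset_f.
have /eqP/setP/(_ (Some (Ordinal ck))) : g @: Q == Some @: [set: 'I_k].
  rewrite eqEcard sub (card_in_imset g_inj) card_imset; last by move=> ? ? [].
  by rewrite cardsT card_ord cQ leqnn.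
rewrite imset_f // => /imsetP[x xQ gx]; exists x => //.
by have := gE x xQ; rewrite -gx /= => -[].
Qed.

(* Galvin's proof: remove a maximal element [a], and in each colour of the rest
   take the highest element [X c] lying on a maximum antichain.  Either [a] is
   incomparable to all the [X c], or the chain formed by [a] and the elements of
   its colour below some [X c < a] meets every maximum antichain. *)
Theorem dilworth (A : {set T}) :
  exists (Q : {set T}) (f : T -> nat), [/\ Q \subset A, antichain Q & chain_coloring A #|Q| f].
Proof.
have [n leAn] := ubnP #|A|; elim: n A leAn => // n IHn A leAn.
have [->|[a0 a0A]] := set_0Vmem A.
  exists set0, (fun=> 0); split; first exact: sub0set.
    by apply/antichainP => x y; rewrite inE.
  by split=> [x|x y]; rewrite inE.
have [a aA amax] := exists_maximal a0A.
have ltD : #|A :\ a| < n by move: leAn; rewrite (cardsD1 a A) aA.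
have [Q [f [sQA aQ fcol]]] := IHn _ ltD; have [fk fch] := fcol.
set k := #|Q| in fcol fk.
pose top x := (x \in A :\ a) && [exists B : {set T},
  [&& B \subset A :\ a, antichain B, #|B| == k & x \in B]].
have exX c : c < k -> exists x, [/\ top x, f x = c &
    forall y, top y -> f y = c -> (y == x) || lt y x].
  move=> ck; have [q qQ fq] := antichain_meets_color fcol aQ sQA erefl ck.
  have qA : q \in A :\ a by rewrite (subsetP sQA).
  have qF : q \in [set y | top y & f y == c].
    rewrite inE fq eqxx andbT /top qA; apply/existsP; exists Q.
    by rewrite sQA aQ qQ eqxx.
  have [x] := exists_maximal qF; rewrite inE => /andP[tx /eqP fx] xmax.
  exists x; split=> // y ty fy.
  have := xmax y; rewrite inE ty fy eqxx => /(_ isT) /negPf nxy.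
  have [yA _] := andP ty; have [xA _] := andP tx.
  by have := fch y x yA xA (etrans fy (esym fx)); rewrite nxy orbF.
have exXf : exists X : 'I_k -> T, forall c, [/\ top (X c), f (X c) = c &
    forall y, top y -> f y = c -> (y == X c) || lt y (X c)].
  pose p (c : 'I_k) x := [&& top x, f x == c &
    [forall y, top y ==> (f y == c) ==> ((y == x) || lt y x)]].
  have pex c : exists x, p c x.
    have [x [tx fx mx]] := exX c (ltn_ord c); exists x.
    rewrite /p tx fx eqxx; apply/forallP => y; apply/implyP => ty.
    by apply/implyP => /eqP; exact: mx.
  exists (fun c => xchoose (pex c)) => c.
  have /and3P[tx /eqP fx /forallP mx] := xchooseP (pex c).
  split=> // y ty fy; move: (mx y); rewrite ty fy eqxx; exact.
have [X Xspec] := exXf.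
have X_inj : injective X.
  move=> c d eX; apply: val_inj; have [_ fc _] := Xspec c.
  by have [_ fd _] := Xspec d; rewrite /= -fc -fd eX.
(* A [k]-antichain through [X d] meets colour [c] in some [y] at or below [X c]; so [X c] below
   [X d] would put [y] below [X d]. *)
have X_anti c d : ~~ lt (X c) (X d).
  have [tc fc mc] := Xspec c; have [td fd md] := Xspec d.
  case/andP: (td) => dA /existsP[B /and4P[sB aB /eqP cB dB]].
  have [y yB fy] := antichain_meets_color fcol aB sB cB (ltn_ord c).
  have ty : top y.
    rewrite /top (subsetP sB) //; apply/existsP; exists B.
    by rewrite sB aB cB eqxx.
  apply/negP => lcd; have := antichainP _ aB y (X d) yB dB.
  by case/orP: (mc y ty fy) => [/eqP->|/lt_trans->//]; rewrite lcd.
have XA c : X c \in A :\ a by have [/andP[]] := Xspec c.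
have [/existsP[c ca]|/existsPn nca] := boolP [exists c, lt (X c) a].
  have [tc fc mc] := Xspec c.
  pose K := a |: [set z in A | (f z == c) && ((z == X c) || lt z (X c))].
  have ltK : #|A :\: K| < n.
    apply: leq_ltn_trans ltD; apply/subset_leq_card/setDS.
    by rewrite sub1set !inE eqxx.
  have [Q1 [f1 [sQ1 aQ1 [f1k f1ch]]]] := IHn _ ltK.
  have sDK (B : {set T}) : B \subset A :\: K -> B \subset A :\ a.
    move/subset_trans; apply; apply/setDS.
    by rewrite sub1set !inE eqxx.
  (* A [k]-antichain avoiding [K] would meet colour [c] in a [top] element, which is at or below
     [X c] and hence in [K]. *)
  have ltQ1 : #|Q1| < k.
    rewrite ltnNge; apply/negP => lekQ.
    have [B [sBQ cB]] : exists B : {set T}, B \subset Q1 /\ #|B| = k.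
      pose s := take k (enum Q1); exists [set x in s]; split.
        by apply/subsetP => x; rewrite inE => /mem_take; rewrite mem_enum.
      rewrite cardsE; have /card_uniqP-> : uniq s by rewrite take_uniq ?enum_uniq.
      by rewrite size_take -cardE; case: ltngtP lekQ.
    have aB : antichain B.
      apply/antichainP => x y xB yB.
      by apply: (antichainP _ aQ1); exact: (subsetP sBQ).
    have sB := subset_trans sBQ sQ1.
    have [y yB fy] := antichain_meets_color fcol aB (sDK _ sB) cB (ltn_ord c).
    have yA := subsetP (sDK _ sB) _ yB.
    have ty : top y.
      rewrite /top yA; apply/existsP; exists B.
      by rewrite sDK // aB cB eqxx.
    have := subsetP sB _ yB; rewrite !inE fy eqxx (mc y ty fy).
    by case/setD1P: yA => _ ->; rewrite !orbT.
  (* [f1] uses only colours below [k.-1] on the rest, so the last colour is free for the chain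
     [K]. *)
  exists Q, (fun z => if z \in K then k.-1 else f1 z).
  split=> //; first exact: subset_trans sQA (subsetDl _ _).
  have k_gt0 : 0 < k by apply: leq_ltn_trans ltQ1.
  split=> [x xA|x y xA yA].
    case: ifPn => [_|xK]; first by rewrite ltn_predL.
    by apply: leq_trans (ltnW ltQ1); apply: f1k; rewrite inE xK.
  have Kch z : z \in K -> z != a ->
      [/\ z \in A :\ a, f z = c & (z == X c) || lt z (X c)].
    by rewrite !inE => /orP[->//|/and3P[-> /eqP-> ->]] ->.
  have Klt z : z \in K -> z != a -> lt z a.
    move=> zK za; have [_ _ /orP[/eqP->//|lz]] := Kch z zK za.
    exact: lt_trans lz ca.
  case: ifPn => xK; case: ifPn => yK.
  - move=> _; have [->|xa] := eqVneq x a; have [->|ya] := eqVneq y a.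
    + by [].
    + by rewrite (Klt y) ?orbT.
    + by rewrite (Klt x) ?orbT.
    + have [xA' fx _] := Kch x xK xa; have [yA' fy _] := Kch y yK ya.
      by apply: fch => //; rewrite fx fy.
  - move=> e; have : f1 y < #|Q1| by apply: f1k; rewrite inE yK.
    by rewrite -e prednK // leqNgt ltQ1.
  - move=> e; have : f1 x < #|Q1| by apply: f1k; rewrite inE xK.
    by rewrite e prednK // leqNgt ltQ1.
  - by apply: f1ch; rewrite inE ?xK ?yK.
have aX : a \notin X @: [set: 'I_k].
  by apply/imsetP => -[c _ ac]; have := XA c; rewrite -ac !inE eqxx.
(* Here [a] extends the antichain of the [X c] and takes the new colour [k]. *)
exists (a |: X @: [set: 'I_k]), (fun z => if z == a then k else f z).
have cQ' : #|a |: X @: [set: 'I_k]| = k.+1.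
  by rewrite cardsU1 aX card_imset // cardsT card_ord.
split.
- apply/subsetP => z; rewrite !inE => /orP[/eqP->//|/imsetP[c _ ->]].
  by have := XA c; rewrite !inE => /andP[].
- apply/antichainP => x y; rewrite !inE.
  move=> /orP[/eqP->|/imsetP[c _ ->]] /orP[/eqP->|/imsetP[d _ ->]] //.
  + by rewrite lt_irr.
  + by apply: amax; have := XA d; rewrite !inE => /andP[].
- rewrite cQ'; split=> [x xA|x y xA yA].
    by case: eqVneq => // xa; apply/ltnW/fk; rewrite !inE xa.
  have [->|xa] := eqVneq x a; have [->|ya] := eqVneq y a; rewrite ?eqxx //.
  + by move=> e; have := fk y; rewrite !inE ya -e ltnn => /(_ yA).
  + by move=> e; have := fk x; rewrite !inE xa e ltnn => /(_ xA).
  + by apply: fch; rewrite !inE ?xa ?ya.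
Qed.

End Dilworth.

(** * Two upper bounds on the thinness *)

Section ThinBounds.
Local Set Implicit Arguments.
Local Unset Strict Implicit.
Local Open Scope nat_scope.
Variable G : sgraph.

Definition clique (K : {set G}) : Prop :=
  {in K &, forall x y, x != y -> edge x y}.

(** The fibres of [c] are the classes of the partition. *)
Lemma thin_le_coloring (I : finType) (v : {ffun 'I_#|G| -> G}) (c : G -> I) :
  injective v ->
  (forall r s t : 'I_#|G|, r < s -> s < t -> c (v r) = c (v s) ->
     edge (v t) (v r) -> edge (v t) (v s)) ->
  thin G <= #|c @: [set: G]|.
Proof.
move=> v_inj cons; pose P := preim_partition c [set: G].
apply: (@leq_trans #|P|); last first.
  have -> : P = (fun i => [set y | i == c y]) @: (c @: [set: G]).
    rewrite -imset_comp; apply: eq_imset => x /=.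
    by apply/setP => y; rewrite !inE.
  exact: leq_imset_card.
rewrite /thin; case: ex_minnP => m _; apply.
apply/existsP; exists v; apply/existsP; exists P.
rewrite preim_partitionP eqxx andbT /=; apply/andP; split; first exact/injectiveP.
apply/forallP=> r; apply/forallP=> s; apply/forallP=> t; apply/implyP.
case/and4P=> rs st /exists_inP[C /imsetP[z _ ->]].
rewrite !inE => /andP[/eqP zr /eqP zs].
by apply: cons => //; rewrite -zr.
Qed.

Lemma ordering_by_key (h : G -> nat) :
  exists2 v : {ffun 'I_#|G| -> G}, injective v &
    forall r s : 'I_#|G|, r < s -> h (v r) <= h (v s).
Proof.
pose le := relpre h leq; pose e := sort le (enum G).
have sz : size e = #|G| by rewrite size_sort -cardE.
have le_tot : total le by move=> x y; exact: leq_total.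
have le_tr : transitive le by move=> x y z; exact: leq_trans.
(* [G] may be empty, so the default, never reached, is drawn from the index. *)
exists [ffun i => nth (enum_val i) e i] => [i j|r s rs]; rewrite !ffunE.
  rewrite (set_nth_default (enum_val i) (enum_val j)) ?sz // => /eqP.
  by rewrite nth_uniq ?sz ?sort_uniq ?enum_uniq // => /eqP/val_inj.
rewrite (set_nth_default (enum_val r) (enum_val s)) ?sz //.
have := sorted_ltn_nth le_tr (enum_val r) (sort_sorted le_tot (enum G)).
by apply; rewrite ?inE ?sz.
Qed.

Lemma thin_le_cardC_clique (K : {set G}) s :
  clique K -> s \notin K -> thin G <= #|~: K|.
Proof.
move=> clK sK; pose h x := if x \in K then 2 else (x == s : nat).
have [v v_inj v_mono] := ordering_by_key h.
(* Sending [K] to [s] merges [s] and [K] into one class and keeps the image of [c] outside [K]. *)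
pose c x := if x \in K then s else x.
apply: leq_trans (_ : #|c @: [set: G]| <= _); last first.
  apply/subset_leq_card/subsetP => _ /imsetP[x _ ->].
  by rewrite !inE /c; case: ifPn.
apply: (thin_le_coloring v_inj) => a b t ab bt cab _.
have nab : v a != v b.
  by apply/eqP => /v_inj e; rewrite e ltnn in ab.
(* Otherwise [v a] would be in [K] and precede a vertex of smaller key, or [c] would fix both
   vertices and make them equal. *)
have bK : v b \in K.
  move: (v_mono _ _ ab) cab nab; rewrite /h /c.
  case: ifPn => aK; case: ifPn => // bK.
    by case: (v b == s).
  by move=> _ ->; rewrite eqxx.
have tK : v t \in K.
  by move: (v_mono _ _ bt); rewrite /h bK; case: ifP => //; case: (v t == s).
apply: clK => //.
by apply/eqP => /v_inj e; rewrite e ltnn in bt.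
Qed.

Lemma co_comparability_thin_le_clique :
  co_comparability G -> exists2 K : {set G}, clique K & thin G <= #|K|.
Proof.
move=> hG; have [v v_inj cmp] : exists2 v : {ffun 'I_#|G| -> G}, injective v &
    forall r s t : 'I_#|G|, r < s -> s < t ->
      ~~ edge (v r) (v s) -> ~~ edge (v s) (v t) -> ~~ edge (v r) (v t).
  have [v /andP[/injectiveP v_inj cmp]] := existsP hG.
  exists v => // r s t rs st ers est.
  have v_neq (i j : 'I_#|G|) : i < j -> (v i : G) != v j.
    by move=> ij; apply/eqP => /v_inj e; rewrite e ltnn in ij.
  have /forallP/(_ s)/forallP/(_ t)/implyP := forallP cmp r.
  rewrite rs st /= /compl_edge (v_neq r s rs) (v_neq s t st) ers est.
  by case/(_ isT)/andP.
pose lt (r s : 'I_#|G|) := (r < s) && ~~ edge (v r) (v s).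
have lt_irr : irreflexive lt by move=> r; rewrite /lt ltnn.
have lt_trans : transitive lt.
  move=> s r t /andP[rs ers] /andP[st est].
  by rewrite /lt (ltn_trans rs st) (cmp r s t).
have [Q [f [_ /antichainP aQ [fk fch]]]] := dilworth lt_irr lt_trans [set: _].
exists (v @: Q).
  move=> _ _ /imsetP[r rQ ->] /imsetP[s sQ ->] nrs.
  have := aQ r s rQ sQ; have := aQ s r sQ rQ; rewrite /lt.
  case: (ltngtP r s) => [_ _|_|/val_inj e]; rewrite ?negbK //=.
    by rewrite edge_sym.
  by rewrite e eqxx in nrs.
have [w vK wK] : bijective v by apply: inj_card_bij; rewrite ?card_ord.
rewrite card_imset //.
pose c x : 'I_#|Q| := Ordinal (fk (w x) (in_setT _)).
apply: leq_trans (_ : #|c @: [set: G]| <= _); last first.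
  by rewrite -[X in _ <= X]card_ord max_card.
apply: (thin_le_coloring v_inj) => r s t rs st [].
rewrite !vK => /(fch _ _ (in_setT _) (in_setT _)).
have -> : lt s r = false by rewrite /lt ltnNge ltnW.
rewrite orbF => /orP[/eqP e|lrs]; first by rewrite e ltnn in rs.
(* A non-edge between [v s] and [v t] extends the chain, and transitivity makes [v r], [v t] a
   non-edge. *)
apply: contraLR => ets; have lst : lt s t by rewrite /lt st edge_sym.
by have /andP[_] := lt_trans _ _ _ lrs lst; rewrite edge_sym.
Qed.

End ThinBounds.

Theorem theorem3p21 (G : sgraph)
  (hG : co_comparability G) (hcard : (2 <= #|G|)%N) :
  (thin G)%:R <= (#|G|%:R / 2%:R :> rat).
Proof.
suff le2 : (thin G * 2 <= #|G|)%N.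
  by rewrite Num.Theory.ler_pdivlMr // -GRing.natrM Num.Theory.ler_nat.
have [K clK leK] := co_comparability_thin_le_clique hG.
(* The first bound needs a vertex outside the clique. If [K] is everything, dropping one vertex
   gives thinness at most 1, enough for two or more vertices. *)
have [KT|/subsetPn[s _ sK]] := boolP ([set: G] \subset K).
  have [s _] : exists s, s \in G by apply/card_gt0P/ltnW.
  have clKs : clique (K :\ s).
    by move=> x y /setD1P[_ xK] /setD1P[_ yK]; exact: clK.
  have := thin_le_cardC_clique clKs (negbT (setD11 s K)).
  move: KT; rewrite subTset => /eqP->; rewrite setTD setCK cards1.
  by case: (thin G) hcard => [|[]].
by have := thin_le_cardC_clique clK sK; have := cardsC K; lia.
Qed.
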